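(* Let $n\ge2$, $\delta,\sigma\in\mathbb{R}$ with $\sigma\ne0$, and $T=(n;\delta,\sigma)$ with eigenvalues $\lambda_1,\dots,\lambda_n$. Let $h\in\{1,\dots,n\}$ be such that $$\frac{|\lambda_h|}{\kappa^{\mathcal{T}}(\lambda_h)}\le\frac{|\lambda_k|}{\kappa^{\mathcal{T}}(\lambda_k)},\qquad k=1,\dots,n.$$ Let $c=\cos\frac{h\pi}{n+1}$ and let $S_*^{\mathcal{T}}=(n;\delta_*,\sigma_* )$ with $$\delta_*=\frac{2\left(nc^2\delta-(n-1)c\sigma\right)}{n-1+2nc^2},\qquad \sigma_*=\frac{(n-1)\sigma-nc\delta}{n-1+2nc^2}.$$ Then $S_*^{\mathcal{T}}$ attains the minimum $\min_{S\in\mathcal{S}\cap\mathcal{T}}\|T-S\|_F$. Hence the structured distance to singularity of $T$ is $$d_F^{\mathcal{T}}(T)=\|T-S_*^{\mathcal{T}}\|_F=\frac{|\lambda_h|}{\kappa^{\mathcal{T}}(\lambda_h)}.$$ Moreover, if $$\frac{|\lambda_h|}{\kappa^{\mathcal{T}}(\lambda_h)}<\frac{|\lambda_k|}{\kappa^{\mathcal{T}}(\lambda_k)},\qquad k=1,\dots,n,\ k\ne h,$$ then $S_*^{\mathcal{T}}$ is the unique closest matrix to $T$ in $\mathcal{S}\cap\mathcal{T}$ (with respect to the Frobenius norm).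
   Context: $(n;d,s)$ denotes the $n\times n$ real symmetric tridiagonal Toeplitz matrix with all diagonal entries equal to $d$ and all sub- and superdiagonal entries equal to $s$. $\mathcal{T}\subset\mathbb{R}^{n\times n}$ is the linear subspace of all such matrices ($d,s\in\mathbb{R}$), and $\mathcal{S}\subset\mathbb{R}^{n\times n}$ is the set of singular matrices. The eigenvalues of $T=(n;\delta,\sigma)$ are numbered as $\lambda_h=\delta+2\sigma\cos\frac{h\pi}{n+1}$, $h=1,\dots,n$. $\|\cdot\|_F$ is the Frobenius norm, and the structured distance to singularity in the Frobenius norm is $d_F^{\mathcal{T}}(T)=\min_{S\in\mathcal{S}\cap\mathcal{T}}\|T-S\|_F$. For $\sigma\ne0$, the structured condition number of $\lambda_h$, with $\mathbf{x}_h$ a real unit-norm eigenvector of $T$ for $\lambda_h$, is $\kappa^{\mathcal{T}}(\lambda_h)=\max_{E\in\mathcal{T},\,\|E\|_F=1}|\mathbf{x}_h^TE\mathbf{x}_h|=\|(\mathbf{x}_h\mathbf{x}_h^T)|\mathcal{T}\|_F=\sqrt{\frac1n+\frac{2}{n-1}\cos^2\frac{h\pi}{n+1}}$, where $A|\mathcal{T}$ denotes the matrix in $\mathcal{T}$ closest to $A$ in the Frobenius norm. *)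

(* Defs.v *)
From mathcomp Require Import all_boot all_order all_algebra.
From mathcomp Require Import classical_sets reals trigo.

Set Implicit Arguments.
Unset Strict Implicit.
Unset Printing Implicit Defensive.

Import Order.TTheory GRing.Theory Num.Theory.

Local Open Scope classical_set_scope.
Local Open Scope ring_scope.

(* The norm that MathComp-Analysis puts on matrices is the sup norm. On column
   vectors, [frobenius] is the Euclidean norm. *)
Definition frobenius (R : realType) (m n : nat) (A : 'M[R]_(m, n)) : R :=
  Num.sqrt (\sum_(i < m) \sum_(j < n) A i j ^+ 2).

(* The matrix written (n; d, s). *)
Definition tridiag_toeplitz (R : realType) (n : nat) (d s : R) : 'M[R]_n :=
  \matrix_(i < n, j < n)
    if i == j then d
    else if (i.+1 == j :> nat) || (j.+1 == i :> nat) then s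
    else 0.

Definition toeplitz_set (R : realType) (n : nat) : set 'M[R]_n :=
  [set A | exists d s : R, A = tridiag_toeplitz n d s].

Definition singular_set (R : realType) (n : nat) : set 'M[R]_n :=
  [set A | A \notin unitmx].

(* The index h runs over 1, ..., n. *)
Definition toeplitz_eigenvalue (R : realType) (n : nat) (d s : R) (h : nat) : R :=
  d + 2 * s * cos (h%:R * pi / n.+1%:R).

Definition unit_eigenvector (R : realType) (n : nat) (A : 'M[R]_n) (lam : R)
    (x : 'cV[R]_n) : Prop :=
  A *m x = lam *: x /\ frobenius x = 1.

(* The supremum also ranges over the unit eigenvectors x for lam. When lam is a
   simple eigenvalue (as for (n; d, s) with s != 0), x is unique up to sign and
   this has no effect on the value. *)
Definition structured_cond (R : realType) (n : nat) (A : 'M[R]_n) (lam : R) : R :=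
  sup [set r | exists (x : 'cV[R]_n) (E : 'M[R]_n),
    [/\ unit_eigenvector A lam x, toeplitz_set E, frobenius E = 1 &
        r = `|(x^T *m E *m x) 0 0| ] ].

Definition structured_dist (R : realType) (n : nat) (A : 'M[R]_n) : R :=
  inf [set frobenius (A - S) | S in @singular_set R n `&` @toeplitz_set R n].

(* Main.v *)
Require Import Defs.
From mathcomp Require Import all_boot all_order all_algebra.
From mathcomp Require Import classical_sets reals trigo.
From mathcomp Require Import ring lra zify.

(** The matrices (n; a, b) with a fixed n form a plane in which the squared
    Frobenius norm is the quadratic form n a^2 + 2 (n-1) b^2, and all of them
    are diagonalized by the same sine vectors, whatever a and b are
    ([sine_vec_eigen], [sine_mx_unit]). The singular ones are therefore the
    union of the n lines a + 2 b cos (k pi / (n+1)) = 0, k = 1, ..., n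
    ([tridiag_toeplitz_singularP]), and the problem is to find the distance
    from the point (delta, sigma) to a finite union of lines in a Euclidean
    plane.

    For a fixed c, completing the square splits the form into a multiple of
    (a + 2 b c)^2 and a multiple of the square of (n-1) b - n c a
    ([frobenius_toeplitz_split]). Two facts follow. First, on the unit sphere
    of the plane |a + 2 b c| has maximum sqrt (1/n + 2 c^2 / (n-1)); as
    x^T E x = a + 2 b c for E = (n; a, b) and every unit eigenvector x of T,
    this maximum is the structured condition number ([structured_condE]).
    Secondly, the distance from T to the k-th line is |lambda_k| divided by the
    k-th condition number ([ratio_le_frobenius]), and the displacement from T
    to its foot on the line is characterized by (n-1) b = n c a
    ([frobenius_eq_ratioP]). The matrix S_star is the foot on the h-th line, so
    it is a nearest point as soon as h minimizes the ratio. If the minimizer h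
    is unique, a nearest point has to lie on the h-th line, and the foot on a
    line is unique. *)

Import Order.TTheory GRing.Theory Num.Theory.

Local Open Scope classical_set_scope.
Local Open Scope ring_scope.

(** * Entries and Frobenius norm of tridiagonal Toeplitz matrices *)

(** Extending the vector by a value 0 at both ends removes the boundary cases:
    every row then acts by the same three-term rule. This serves both for the
    sine vectors, which vanish at 0 and n+1, and for counting the nonzero
    entries. *)
Lemma tridiag_toeplitz_sum (R : realType) (n : nat) (d s : R) (f : nat -> R)
    (i : 'I_n) :
  f 0%N = 0 -> f n.+1 = 0 ->
  \sum_(j < n) tridiag_toeplitz n d s i j * f j.+1 =
  d * f i.+1 + s * (f i + f i.+2).
Proof.
move=> f0 fn.
have pick (m : nat) :
    \sum_(j < n) (m == j :> nat)%:R * f j.+1 = if (m < n)%N then f m.+1 else 0.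
  case: ifPn => [mn|].
    rewrite (bigD1 (Ordinal mn)) //= eqxx mul1r big1 ?addr0// => j.
    by rewrite -val_eqE /= eq_sym => /negPf ->; rewrite mul0r.
  move=> mn; rewrite big1 // => j _; case: eqP => [mj|]; last by rewrite mul0r.
  by rewrite mj ltn_ord in mn.
transitivity (\sum_(j < n) (d * ((i == j :> nat)%:R * f j.+1) +
   s * (((i.-1 == j :> nat)%:R * f j.+1) *+ (0 < i)%N
        + (i.+1 == j :> nat)%:R * f j.+1))).
  apply: eq_bigr => j _; rewrite mxE -(inj_eq val_inj) /=.
  have -> : (j.+1 == i :> nat) = (0 < i)%N && (i.-1 == j :> nat) by lia.
  have [->|ij] /= := eqVneq (i : nat) j.
    have -> : (j.-1 == j :> nat) = (j == 0 :> nat) by lia.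
    have -> : (j.+1 == j :> nat) = false by lia.
    by case: (j : nat) => [|?] /=; ring.
  have [ij1|ij1] := eqVneq (i.+1 : nat) j => /=.
    have -> : (i.-1 == j :> nat) = false by lia.
    by case: (0 < i)%N => /=; ring.
  by case: (0 < i)%N; case: (i.-1 == j :> nat) => /=; ring.
rewrite big_split /= -!mulr_sumr big_split /= sumrMnl !pick ltn_ord.
congr (_ + _ * (_ + _)).
  case: (i : nat) (ltn_ord i) => [|m] mn /=; first by rewrite mulr0n f0.
  by rewrite mulr1n (ltnW mn).
case: ltnP => // ni; suff -> : i.+2 = n.+1 by [].
by have := ltn_ord i; lia.
Qed.

Lemma frobenius_tridiag_toeplitz (R : realType) (n : nat) (d s : R) :
  (0 < n)%N ->
  frobenius (tridiag_toeplitz n d s) =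
  Num.sqrt (n%:R * d ^+ 2 + 2 * (n%:R - 1) * s ^+ 2).
Proof.
case: n => [//|n] _; rewrite /frobenius; congr Num.sqrt.
(* Squaring the entries gives (n; d^2, s^2), whose entries are added up by
   applying it to the indicator of 1, ..., n. *)
pose f (j : nat) : R := (0 < j <= n.+1)%N%:R.
transitivity (\sum_(i < n.+1) (d ^+ 2 * f i.+1 + s ^+ 2 * (f i + f i.+2))).
  apply: eq_bigr => i _.
  rewrite -tridiag_toeplitz_sum /f ?ltnn ?andbF//; apply: eq_bigr => j _.
  rewrite !ltnS /= -ltnS ltn_ord mulr1 !mxE.
  by case: ifP => // _; case: ifP => // _; rewrite expr0n.
rewrite big_split /= -!mulr_sumr big_split /=.
have -> : \sum_(i < n.+1) f i.+1 = n.+1%:R.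
  rewrite (eq_bigr (fun=> 1)) ?sumr_const ?card_ord// => i _.
  by rewrite /f ltn_ord.
have -> : \sum_(i < n.+1) f i = n%:R.
  rewrite big_ord_recl [f _]/= add0r (eq_bigr (fun=> 1)).
    by rewrite sumr_const card_ord.
  by move=> i _; rewrite /f /= /bump /= add1n ltnS ltnW.
have -> : \sum_(i < n.+1) f i.+2 = n%:R.
  have fn : f n.+2 = 0 by rewrite /f ltnn andbF.
  rewrite big_ord_recr /= fn addr0 (eq_bigr (fun=> 1)).
    by rewrite sumr_const card_ord.
  by move=> i _; rewrite /f /= ltnS ltn_ord.
by rewrite -natr1; ring.
Qed.

Lemma tridiag_toeplitzB (R : realType) (n : nat) (d s d' s' : R) :
  tridiag_toeplitz n d s - tridiag_toeplitz n d' s' =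
  tridiag_toeplitz n (d - d') (s - s').
Proof.
apply/matrixP => i j; rewrite !mxE.
by case: ifP => // _; case: ifP => // _; rewrite subr0.
Qed.

Lemma tridiag_toeplitzE (R : realType) (n : nat) (d s : R) :
  tridiag_toeplitz n d s = d%:M + s *: tridiag_toeplitz n 0 1.
Proof.
apply/matrixP => i j; rewrite !mxE.
by case: eqP => _ /=; [|case: ifP => _]; rewrite ?mulr1n ?mulr0n; ring.
Qed.

Lemma trmx_tridiag_toeplitz (R : realType) (n : nat) (d s : R) :
  (tridiag_toeplitz n d s)^T = tridiag_toeplitz n d s.
Proof. by apply/matrixP => i j; rewrite !mxE eq_sym orbC. Qed.

(** * Diagonalization by sine vectors *)

Definition sine_vec (R : realType) (n k : nat) : 'cV[R]_n :=
  \col_i sin (i.+1%:R * (k%:R * pi / n.+1%:R)).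

Lemma sin_natr_pi (R : realType) (k : nat) : sin (k%:R * pi) = 0 :> R.
Proof.
elim: k => [|k IH]; first by rewrite mul0r sin0.
by rewrite -natr1 mulrDl mul1r sinDpi IH oppr0.
Qed.

(** This is sin (x - t) + sin (x + t) = 2 cos t sin x; the end rows obey the
    same rule because the angle is chosen so that sin ((n+1) t) = 0. *)
Lemma sine_vec_eigen (R : realType) (n k : nat) (d s : R) :
  tridiag_toeplitz n d s *m sine_vec R n k =
  toeplitz_eigenvalue n d s k *: sine_vec R n k.
Proof.
apply/colP => i; rewrite !mxE /toeplitz_eigenvalue.
set t := k%:R * pi / n.+1%:R.
under eq_bigr do rewrite [sine_vec _ _ _ _ _]mxE.
rewrite (@tridiag_toeplitz_sum R n d s (fun m => sin (m%:R * t)) i).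
- have -> : i%:R * t = i.+1%:R * t - t by rewrite -natr1; ring.
  have -> : i.+2%:R * t = i.+1%:R * t + t by rewrite -[i.+2%:R]natr1; ring.
  by rewrite sinB sinD; ring.
- by rewrite mul0r sin0.
- by rewrite /t mulrC divfK ?pnatr_eq0// sin_natr_pi.
Qed.

Lemma angle_itv (R : realType) (n k : nat) : (1 <= k <= n)%N ->
  0 < k%:R * (pi : R) / n.+1%:R < pi.
Proof.
move=> /andP[k0 kn]; have p0 := pi_gt0 R; apply/andP; split.
  by rewrite !mulr_gt0 ?invr_gt0 ?ltr0n.
by rewrite ltr_pdivrMr ?ltr0n// mulrC ltr_pM2l// ltr_nat ltnS.
Qed.

(** The first entry is sin (k pi / (n+1)), and its angle lies strictly between
    0 and pi. *)
Lemma frobenius_sine_vec_gt0 (R : realType) (n k : nat) : (1 <= k <= n)%N ->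
  0 < frobenius (sine_vec R n k).
Proof.
case: n => [|n] kn; first by lia.
rewrite sqrtr_gt0 big_ord_recl big_ord1 !mxE mul1r ltr_wpDr //.
  by do 2 (apply: sumr_ge0 => ? _); exact: sqr_ge0.
by rewrite exprn_gt0// sin_gt0_pi// angle_itv.
Qed.

Lemma toeplitz_eigenvalue_inj (R : realType) (n k l : nat) :
  (1 <= k <= n)%N -> (1 <= l <= n)%N ->
  toeplitz_eigenvalue n 0 1 k = toeplitz_eigenvalue n 0 1 l :> R -> k = l.
Proof.
move=> kn ln; rewrite /toeplitz_eigenvalue !add0r mulr1.
move/(mulfI (_ : 2 != 0 :> R)); rewrite pnatr_eq0 => /(_ isT) /cos_inj.
have /andP[k0 k1] := angle_itv R n k kn.
have /andP[l0 l1] := angle_itv R n l ln.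
rewrite !in_itv /= !ltW // => /(_ isT isT).
move/(mulIf (_ : n.+1%:R^-1 != 0)); rewrite invr_neq0 ?pnatr_eq0// => /(_ isT).
by move/(mulIf (lt0r_neq0 (pi_gt0 R)))/eqP; rewrite eqr_nat => /eqP.
Qed.

Definition sine_mx (R : realType) (n : nat) : 'M[R]_n :=
  \matrix_(i, k) sine_vec R n k.+1 i 0.

Lemma sine_mx_diagonalizes (R : realType) (n : nat) (d s : R) :
  tridiag_toeplitz n d s *m sine_mx R n =
  sine_mx R n *m diag_mx (\row_(k < n) toeplitz_eigenvalue n d s k.+1).
Proof.
apply/matrixP => i k; rewrite mul_mx_diag !mxE mulrC.
have /colP/(_ i) := sine_vec_eigen R n k.+1 d s; rewrite !mxE => <-.
by apply: eq_bigr => j _; rewrite !mxE.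
Qed.

(** The sine vectors are eigenvectors of the symmetric matrix (n; 0, 1) for
    distinct eigenvalues, hence orthogonal: their Gram matrix commutes with a
    diagonal matrix with distinct entries, so it is diagonal, and its diagonal
    is positive. *)
Lemma sine_mx_unit (R : realType) (n : nat) : sine_mx R n \in unitmx.
Proof.
set V := sine_mx R n; pose G := V^T *m V.
pose D := diag_mx (\row_(k < n) (toeplitz_eigenvalue n 0 1 k.+1 : R)).
have DG : D *m G = G *m D.
  rewrite -{1}[D]tr_diag_mx /G mulmxA -trmx_mul -sine_mx_diagonalizes trmx_mul.
  by rewrite trmx_tridiag_toeplitz -!mulmxA sine_mx_diagonalizes.
have Gdiag : G = diag_mx (\row_k frobenius (sine_vec R n k.+1) ^+ 2).
  apply/matrixP => k l; rewrite !mxE.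
  have [<-|kl] := eqVneq k l.
    rewrite mulr1n sqr_sqrtr.
      by apply: eq_bigr => i _; rewrite big_ord1 !mxE.
    by do 2 (apply: sumr_ge0 => ? _); exact: sqr_ge0.
  rewrite mulr0n.
  have /matrixP/(_ k l) := DG; rewrite mul_diag_mx mul_mx_diag !mxE.
  move/eqP; rewrite mulrC -subr_eq0 -mulrBr mulf_eq0 subr_eq0 => /orP[/eqP//|].
  move=> /eqP /toeplitz_eigenvalue_inj; rewrite !ltn_ord => /(_ isT isT) [].
  by move/val_inj => E; rewrite E eqxx in kl.
have : \det G != 0.
  rewrite Gdiag det_diag; apply/prodf_neq0 => k _.
  by rewrite mxE expf_neq0// lt0r_neq0// frobenius_sine_vec_gt0//=.
by rewrite unitmxE unitfE det_mulmx mulf_eq0 negb_or => /andP[].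
Qed.

(** The eigenbasis does not depend on d and s, so the determinant is the
    product of all the eigenvalues, even in the degenerate case s = 0. *)
Lemma tridiag_toeplitz_singularP (R : realType) (n : nat) (d s : R) :
  tridiag_toeplitz n d s \notin unitmx <->
  exists2 k : nat, (1 <= k <= n)%N & toeplitz_eigenvalue n d s k = 0.
Proof.
have -> : (tridiag_toeplitz n d s \notin unitmx) =
    (\prod_(k < n) toeplitz_eigenvalue n d s k.+1 == 0).
  have /(congr1 determinant) := sine_mx_diagonalizes R n d s.
  have V0 : \det (sine_mx R n) != 0.
    by have := sine_mx_unit R n; rewrite unitmxE unitfE.
  rewrite !det_mulmx mulrC det_diag => /(mulfI V0) detT.
  rewrite unitmxE unitfE negbK detT; congr (_ == 0).
  by apply: eq_bigr => k _; rewrite mxE.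
split=> [/prodf_eq0|].
  by case=> k _ /eqP k0; exists k.+1; rewrite ?ltn_ord.
case=> -[//|k] /andP[_ kn] k0; apply/prodf_eq0.
by exists (Ordinal kn) => //=; apply/eqP.
Qed.

(** * The Euclidean geometry of the plane of parameters *)

(** The norm of the linear functional (a, b) |-> a + 2 b c dual to the norm
    sqrt (n a^2 + 2 (n-1) b^2), hence the closed form of the condition number
    of an eigenvalue d + 2 s c. *)
Definition cond_formula (R : realType) (n : nat) (c : R) : R :=
  Num.sqrt (1 / n%:R + 2 / (n%:R - 1) * c ^+ 2).

Lemma toeplitz_den_gt0 (R : realType) (n : nat) (c : R) : (2 <= n)%N ->
  0 < n%:R - 1 + 2 * n%:R * c ^+ 2.
Proof.
move=> n2; have N1 : 1 < n%:R :> R by rewrite ltr1n.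
by rewrite ltr_wpDr ?subr_gt0// mulr_ge0 ?sqr_ge0// mulr_ge0 ?ler0n.
Qed.

Lemma cond_formula_gt0 (R : realType) (n : nat) (c : R) : (2 <= n)%N ->
  0 < cond_formula R n c.
Proof.
move=> n2; rewrite sqrtr_gt0 ltr_wpDr//; last by rewrite divr_gt0 ?ltr0n// ltnW.
by rewrite mulr_ge0 ?sqr_ge0// divr_ge0// subr_ge0 ler1n ltnW.
Qed.

(** Orthogonal decomposition of (a, b) for the form n a^2 + 2 (n-1) b^2, along
    and across the line a + 2 b c = 0. The first term is the squared distance
    to that line; the second vanishes exactly on its orthogonal complement. *)
Lemma frobenius_toeplitz_split (R : realType) (n : nat) (a b c : R) :
  (2 <= n)%N ->
  frobenius (tridiag_toeplitz n a b) ^+ 2 =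
  ((a + 2 * b * c) / cond_formula R n c) ^+ 2 +
  2 * ((n%:R - 1) * b - n%:R * c * a) ^+ 2 / (n%:R - 1 + 2 * n%:R * c ^+ 2).
Proof.
move=> n2; have N1 : 1 < n%:R :> R by rewrite ltr1n.
have k0 := cond_formula_gt0 R n c n2.
rewrite frobenius_tridiag_toeplitz ?(ltnW n2)// expr_div_n !sqr_sqrtr; first last.
- by rewrite addr_ge0// mulr_ge0 ?sqr_ge0//; lra.
- by move: k0; rewrite sqrtr_gt0 => /ltW.
have N0 : n%:R != 0 :> R by lra.
have NB0 : n%:R - 1 != 0 :> R by lra.
have D0 := lt0r_neq0 (toeplitz_den_gt0 R n c n2).
by field; rewrite N0 NB0 D0.
Qed.

Lemma frobenius_ge0 (R : realType) (m n : nat) (A : 'M[R]_(m, n)) :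
  0 <= frobenius A.
Proof. exact: sqrtr_ge0. Qed.

(** Read with a, b the difference of the parameters of T and of a singular
    matrix on the line of c, this bounds the distance between them from below;
    read on the unit sphere, it bounds the condition number from above. *)
Lemma ratio_le_frobenius (R : realType) (n : nat) (a b c : R) : (2 <= n)%N ->
  `|a + 2 * b * c| / cond_formula R n c <= frobenius (tridiag_toeplitz n a b).
Proof.
move=> n2; have k0 := cond_formula_gt0 R n c n2.
rewrite -(@ler_pXn2r _ 2) ?nnegrE ?frobenius_ge0 ?divr_ge0 ?(ltW k0)//.
have -> : (`|a + 2 * b * c| / cond_formula R n c) ^+ 2 =
    ((a + 2 * b * c) / cond_formula R n c) ^+ 2.
  by rewrite !expr_div_n real_normK ?num_real.
rewrite [leRHS](frobenius_toeplitz_split R n a b c n2) lerDl.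
by apply: divr_ge0; [rewrite mulr_ge0 ?sqr_ge0|exact/ltW/toeplitz_den_gt0].
Qed.

(** The equality case of [ratio_le_frobenius]: the component of (a, b) along
    the line a + 2 b c = 0 vanishes. It certifies S_star and the maximizer for
    the condition number, and it gives uniqueness. *)
Lemma frobenius_eq_ratioP (R : realType) (n : nat) (a b c : R) : (2 <= n)%N ->
  frobenius (tridiag_toeplitz n a b) = `|a + 2 * b * c| / cond_formula R n c
  <-> (n%:R - 1) * b = n%:R * c * a.
Proof.
move=> n2; have k0 := cond_formula_gt0 R n c n2.
have D0 := toeplitz_den_gt0 R n c n2.
have split_sq := frobenius_toeplitz_split R n a b c n2.
have sqE : (`|a + 2 * b * c| / cond_formula R n c) ^+ 2 =
    ((a + 2 * b * c) / cond_formula R n c) ^+ 2.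
  by rewrite !expr_div_n real_normK ?num_real.
split=> [E|E].
  move: split_sq; rewrite E sqE -[LHS]addr0 => /addrI/esym/eqP.
  rewrite mulf_eq0 invr_eq0 (gt_eqF D0) orbF mulf_eq0 pnatr_eq0 /=.
  by rewrite sqrf_eq0 subr_eq0 => /eqP.
apply/eqP; rewrite -(@eqrXn2 _ 2) ?frobenius_ge0 ?divr_ge0 ?(ltW k0)//.
by rewrite split_sq sqE E subrr expr0n /= mulr0 mul0r addr0.
Qed.

(** * The structured condition number *)

(** For s != 0, an eigenvector of (n; d, s) is also one of (n; 0, 1), hence of
    every tridiagonal Toeplitz matrix. So the value of the quadratic form at x
    depends only on the eigenvalue, and not on the choice of x. *)
Lemma eigenvector_form (R : realType) (n : nat) (d s l a b : R) (x : 'cV[R]_n) :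
  s != 0 -> unit_eigenvector (tridiag_toeplitz n d s) (d + 2 * s * l) x ->
  (x^T *m tridiag_toeplitz n a b *m x) 0 0 = a + 2 * b * l.
Proof.
move=> s0 [Ax x1].
have Jx : tridiag_toeplitz n 0 1 *m x = (2 * l) *: x.
  apply: (scalerI s0); move: Ax.
  rewrite tridiag_toeplitzE mulmxDl mul_scalar_mx -scalemxAl scalerDl => /addrI->.
  by rewrite scalerA; congr (_ *: _); ring.
rewrite tridiag_toeplitzE -mulmxA mulmxDl mul_scalar_mx -scalemxAl Jx scalerA.
rewrite -scalerDl -scalemxAr mxE.
have -> : (x^T *m x) 0 0 = frobenius x ^+ 2.
  rewrite sqr_sqrtr; last by do 2 (apply: sumr_ge0 => ? _); exact: sqr_ge0.
  by rewrite mxE; apply: eq_bigr => i _; rewrite big_ord1 !mxE.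
by rewrite x1; ring.
Qed.

Lemma unit_eigenvector_ex (R : realType) (n : nat) (d s : R) (h : nat) :
  (1 <= h <= n)%N -> exists x : 'cV[R]_n,
  unit_eigenvector (tridiag_toeplitz n d s) (toeplitz_eigenvalue n d s h) x.
Proof.
move=> hn; have v0 := frobenius_sine_vec_gt0 R n h hn.
exists ((frobenius (sine_vec R n h))^-1 *: sine_vec R n h); split.
  by rewrite -scalemxAr sine_vec_eigen !scalerA mulrC.
rewrite {1}/frobenius.
under eq_bigr do under eq_bigr do rewrite mxE exprMn.
under eq_bigr do rewrite -mulr_sumr.
rewrite -mulr_sumr sqrtrM ?sqr_ge0// sqrtr_sqr gtr0_norm ?invr_gt0//.
by rewrite mulVf ?lt0r_neq0.
Qed.

(** The supremum is a maximum of |a + 2 b c| over the unit sphere of the plane,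
    attained at the unit vector orthogonal to the line a + 2 b c = 0. *)
Lemma structured_condE (R : realType) (n : nat) (d s : R) (h : nat) :
  (2 <= n)%N -> s != 0 -> (1 <= h <= n)%N ->
  structured_cond (tridiag_toeplitz n d s) (toeplitz_eigenvalue n d s h) =
  cond_formula R n (cos (h%:R * pi / n.+1%:R)).
Proof.
move=> n2 s0 hn; set c := cos _.
have N1 : 1 < n%:R :> R by rewrite ltr1n.
have k0 := cond_formula_gt0 R n c n2.
have [x xh] := unit_eigenvector_ex R n d s h hn.
rewrite /structured_cond; set A := (X in sup X).
have ubA : ubound A (cond_formula R n c).
  move=> _ [y [_ [yh [a [b ->]] E1 ->]]].
  rewrite (eigenvector_form _ _ _ _ _ _ _ _ s0 yh).
  have := ratio_le_frobenius R n a b c n2.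
  by rewrite E1 ler_pdivrMr// mul1r.
have attained : A (cond_formula R n c).
  pose k := cond_formula R n c.
  (* The direction (1/n, c/(n-1)) solves (n-1) b = n c a, and a + 2 b c takes
     the value k^2 there; the factor 1/k makes its norm 1. *)
  pose a := k^-1 / n%:R; pose b := k^-1 * c / (n%:R - 1).
  have N0 : n%:R != 0 :> R by lra.
  have NB0 : n%:R - 1 != 0 :> R by lra.
  have kn0 : k != 0 by exact: lt0r_neq0.
  have abk : a + 2 * b * c = k.
    have k2 : k ^+ 2 = 1 / n%:R + 2 / (n%:R - 1) * c ^+ 2.
      by rewrite sqr_sqrtr//; move: k0; rewrite sqrtr_gt0 => /ltW.
    transitivity (k^-1 * k ^+ 2); last by field.
    by rewrite k2 /a /b; field; rewrite N0 NB0 kn0.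
  exists x, (tridiag_toeplitz n a b); split => //; first by exists a, b.
    have /frobenius_eq_ratioP-> // : (n%:R - 1) * b = n%:R * c * a.
      by rewrite /a /b; field; rewrite N0 NB0 kn0.
    by rewrite abk gtr0_norm// divff.
  by rewrite (eigenvector_form _ _ _ _ _ _ _ _ s0 xh) abk gtr0_norm.
apply/le_anti/andP; split.
  by apply: ge_sup => //; exists (cond_formula R n c).
by apply: ub_le_sup => //; exists (cond_formula R n c).
Qed.

(** * The nearest singular matrix *)

Theorem theorem4p3 (R : realType) (n : nat) (delta sigma : R) (h : nat) :
  (2 <= n)%N -> sigma != 0 -> (1 <= h <= n)%N ->
  let T := tridiag_toeplitz n delta sigma in
  let lambda := toeplitz_eigenvalue n delta sigma in
  let kappa := fun k : nat => structured_cond T (lambda k) in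
  (forall k : nat, (1 <= k <= n)%N ->
     `|lambda h| / kappa h <= `|lambda k| / kappa k) ->
  let c : R := cos (h%:R * pi / n.+1%:R) in
  let den : R := n%:R - 1 + 2 * n%:R * c ^+ 2 in
  let delta_star := 2 * (n%:R * c ^+ 2 * delta - (n%:R - 1) * c * sigma) / den in
  let sigma_star := ((n%:R - 1) * sigma - n%:R * c * delta) / den in
  let S_star := tridiag_toeplitz n delta_star sigma_star in
  [/\ (@singular_set R n `&` @toeplitz_set R n) S_star
      /\ (forall S : 'M[R]_n, (@singular_set R n `&` @toeplitz_set R n) S ->
            frobenius (T - S_star) <= frobenius (T - S)),
      structured_dist T = frobenius (T - S_star),
      frobenius (T - S_star) = `|lambda h| / kappa h
    & (forall k : nat, (1 <= k <= n)%N -> k != h ->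
         `|lambda h| / kappa h < `|lambda k| / kappa k) ->
      forall S : 'M[R]_n, (@singular_set R n `&` @toeplitz_set R n) S ->
        (forall S' : 'M[R]_n, (@singular_set R n `&` @toeplitz_set R n) S' ->
           frobenius (T - S) <= frobenius (T - S')) ->
        S = S_star].
Proof.
move=> n2 s0 hn T lambda kappa hmin c den ds ss S_star.
have kappaE k : (1 <= k <= n)%N ->
    kappa k = cond_formula R n (cos (k%:R * pi / n.+1%:R)).
  exact: structured_condE.
have N1 : 1 < n%:R :> R by rewrite ltr1n.
have D0 : den != 0 by exact/lt0r_neq0/toeplitz_den_gt0.
have star_kernel : ds + 2 * ss * c = 0.
  by rewrite /ds /ss; field.
have star_dist : frobenius (T - S_star) = `|lambda h| / kappa h.
  rewrite tridiag_toeplitzB (kappaE h hn) -/c.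
  have -> : lambda h = (delta - ds) + 2 * (sigma - ss) * c.
    rewrite -[LHS]subr0 -star_kernel /lambda /toeplitz_eigenvalue -/c; ring.
  apply/frobenius_eq_ratioP => //; rewrite /ds /ss /den; field.
  exact: D0.
have ratio_le d s k : (1 <= k <= n)%N -> toeplitz_eigenvalue n d s k = 0 ->
    `|lambda k| / kappa k <= frobenius (T - tridiag_toeplitz n d s).
  move=> kn k0; rewrite tridiag_toeplitzB (kappaE k kn).
  apply: le_trans (ratio_le_frobenius _ _ _ _ _ n2).
  rewrite -[lambda k]subr0 -k0 /lambda /toeplitz_eigenvalue.
  set z := cos _; suff -> : delta + 2 * sigma * z - (d + 2 * s * z) =
    delta - d + 2 * (sigma - s) * z by [].
  by ring.
have star_in : (@singular_set R n `&` @toeplitz_set R n) S_star.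
  by split; [apply/tridiag_toeplitz_singularP; exists h|exists ds, ss].
have star_min S : (@singular_set R n `&` @toeplitz_set R n) S ->
    frobenius (T - S_star) <= frobenius (T - S).
  case=> /[swap] -[d [s ->]] /tridiag_toeplitz_singularP[k kn k0].
  by rewrite star_dist (le_trans (hmin k kn))// ratio_le.
split=> //.
  have star_lb : lbound [set frobenius (T - S) |
      S in @singular_set R n `&` @toeplitz_set R n] (frobenius (T - S_star)).
    by move=> _ [S SS <-]; exact: star_min.
  apply/le_anti/andP; split.
    by apply: ge_inf; [exists (frobenius (T - S_star))|exists S_star].
  by apply: lb_le_inf => //; exists (frobenius (T - S_star)), S_star.
move=> hlt S [/[swap] -[d [s ->]] /tridiag_toeplitz_singularP[k kn k0]] Smin.
have := Smin _ star_in; rewrite star_dist => Sle.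
have kh : k = h.
  apply/eqP; apply: contraTT (le_trans (ratio_le d s k kn k0) Sle) => kh.
  by rewrite -ltNge hlt.
have Seq : frobenius (T - tridiag_toeplitz n d s) = `|lambda h| / kappa h.
  by apply/le_anti; rewrite Sle -kh ratio_le.
(* S lies on the h-th line and T - S is orthogonal to it: two independent
   linear equations, which determine d and s. *)
have dE : d = - (2 * s * c).
  by apply/eqP; rewrite -addr_eq0 /c -kh; apply/eqP.
have perp : (n%:R - 1) * (sigma - s) = n%:R * c * (delta - d).
  apply/frobenius_eq_ratioP => //; rewrite -tridiag_toeplitzB Seq (kappaE h hn).
  congr (`|_| / _); rewrite /lambda /toeplitz_eigenvalue -/c dE; ring.
have sE : s = ss.
  apply: (mulIf D0); rewrite divfK//; move: perp; rewrite dE /den => perp.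
  apply/eqP; rewrite -subr_eq0; apply/eqP.
  transitivity (n%:R * c * (delta - - (2 * s * c)) - (n%:R - 1) * (sigma - s)).
    by ring.
  by rewrite perp subrr.
rewrite /S_star -sE dE; congr tridiag_toeplitz.
by rewrite -[RHS](addrK (2 * ss * c)) star_kernel sE sub0r.
Qed.
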